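(* For all $$(\hat\beta_{0c},\hat{\boldsymbol\beta}_c)\in\mathop{\arg\min}_{(\beta_0,\boldsymbol\beta)\in\mathbb R^{p+1}}\big\{\hat{\mathcal R}_c(\beta_0,\boldsymbol\beta)+\text{regularization}\big\}\quad\text{with}\quad \hat{\mathcal R}_c(\beta_0,\boldsymbol\beta)=\frac1n\sum_{i=1}^n\mathcal L_\tau\Big(1-\sum_{j=0}^p\bar x''_{i,j+1}\beta_j\Big),$$ one can get $\hat\beta_{0c}$ and $\hat{\boldsymbol\beta}_c$ by solving the following convex optimization form: $$\min_{(\beta_0,\boldsymbol\beta)\in\mathbb R^{p+1}}\big\{\hat{\mathcal R}_r(\beta_0,\boldsymbol\beta)+\tilde\tau\times\text{regularization}\big\}\quad\text{with}\quad \hat{\mathcal R}_r(\beta_0,\boldsymbol\beta)=\frac1n\sum_{i=1}^n\rho_{\tilde\tau}\Big(\tilde y_i-\sum_{j=0}^p\tilde x_{i,j+1}\beta_j\Big),$$ where $\tilde\tau=1/(1+\tau)$, $\tilde y_i=1$ and $\tilde x_{i,j+1}=\bar x''_{i,j+1}$.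
   Context: Data: $n$ observations $(y_i,x_{i1},\dots,x_{ip})$, $i=1,\dots,n$, with labels $y_i\in\{-1,1\}$ and real features; $\boldsymbol X=(x_{ij})$ is the $n\times p$ design matrix, $\beta_0$ is the intercept and $\boldsymbol\beta=(\beta_1,\dots,\beta_p)^\top$. The number $\bar x''_{i,j+1}$ ($0\le j\le p$) is the entry $(i,j+1)$ of the matrix $\boldsymbol Y[\boldsymbol 1_n,\boldsymbol X]$, where $\boldsymbol Y=\mathrm{diag}(y_1,\dots,y_n)$ and $\boldsymbol 1_n$ is the all-ones vector; that is, $\bar x''_{i,1}=y_i$ and $\bar x''_{i,j+1}=y_ix_{ij}$ for $1\le j\le p$. Pinball loss with parameter $\tau\ge 0$: $\mathcal L_\tau(u)=u$ if $u\ge0$ and $\mathcal L_\tau(u)=-\tau u$ if $u<0$. Quantile loss: $\rho_{\tau'}(u)=u(\tau'-\mathbf 1\{u<0\})$ for $\tau'\in[0,1]$. ''Regularization'' denotes a regularization term on the coefficients, the same term in both problems; an example is the sparse fused Lasso term $\lambda_1\sum_{j=1}^p|\beta_j|+\lambda_2\sum_{j=2}^p|\beta_j-\beta_{j-1}|$ with $\lambda_1,\lambda_2\ge0$, but other regularization terms are also allowed.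
   Formalization: The second problem is proved to be convex only when the regularization term is convex (it fails for example for the term −β₁²); the equality of the two sets of minimizers is proved for every real-valued regularization term. *)

(* Defs.v *)
From HB Require Import structures.
From mathcomp Require Import all_boot all_order all_algebra.
From mathcomp Require Import boolp classical_sets reals convex.

Set Implicit Arguments.
Unset Strict Implicit.
Unset Printing Implicit Defensive.

Import Order.TTheory GRing.Theory Num.Theory.

Local Open Scope classical_set_scope.
Local Open Scope ring_scope.

Definition argmin (R : realType) (T : Type) (f : T -> R) : set T :=
  [set b | forall c, f b <= f c].

Definition pinball_loss (R : realType) (tau u : R) : R :=
  if 0 <= u then u else - tau * u.

Definition quantile_loss (R : realType) (tau u : R) : R :=
  u * (tau - (if u < 0 then 1 else 0)).

(* The matrix Y [1_n, X], with Y = diag (y_1, ..., y_n). Columns are numbered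
   from 0, so that its entry (i, j) is the one written with column index j + 1
   when columns are numbered from 1. *)
Definition signed_design (R : realType) (n p : nat)
    (y : 'rV[R]_n) (X : 'M[R]_(n, p)) : 'M[R]_(n, 1 + p) :=
  diag_mx y *m row_mx (const_mx 1 : 'cV[R]_n) X.

(* In both risks, the argument b of type 'cV[R]_(1 + p) is the vector
   (beta_0, beta_1, ..., beta_p), the intercept being its coordinate 0. *)
Definition classification_risk (R : realType) (n p : nat) (tau : R)
    (xbar : 'M[R]_(n, 1 + p)) (b : 'cV[R]_(1 + p)) : R :=
  n%:R^-1 *
  \sum_(i < n) pinball_loss tau (1 - \sum_(j < 1 + p) xbar i j * b j 0).

Definition regression_risk (R : realType) (n p : nat) (tau : R)
    (yt : 'cV[R]_n) (xt : 'M[R]_(n, 1 + p)) (b : 'cV[R]_(1 + p)) : R :=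
  n%:R^-1 *
  \sum_(i < n) quantile_loss tau (yt i 0 - \sum_(j < 1 + p) xt i j * b j 0).

(* Main.v *)
(** The identity [rho_(1/(1+tau)) = L_tau / (1+tau)] makes the regression
    objective the positive multiple [1/(1+tau)] of the classification one. It is
    convex with the regularization because, for [tau >= 0], the pinball loss is
    the maximum of the linear functions [u] and [- tau u]. *)
Require Import Defs.
From mathcomp Require Import all_boot all_order all_algebra.
From mathcomp Require Import boolp classical_sets reals convex.
From mathcomp Require Import interval_inference ring lra.

Set Implicit Arguments.
Unset Strict Implicit.
Unset Printing Implicit Defensive.

Import Order.TTheory GRing.Theory Num.Theory.

Local Open Scope classical_set_scope.
Local Open Scope ring_scope.

Lemma argmin_pscale (R : realType) (T : Type) (k : R) (f : T -> R) :
  0 < k -> argmin (fun b => k * f b) = argmin f.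
Proof.
move=> k0; apply/seteqP; split => b /= fb c; have := fb c;
  by rewrite ler_pM2l.
Qed.

(** On each side of 0 both losses are linear, so it is enough to compare slopes. The negative side
    uses [1 / (1 + tau) - 1 = - tau / (1 + tau)]. *)
Lemma quantile_lossE (R : realType) (tau u : R) : 1 + tau != 0 ->
  quantile_loss (1 / (1 + tau)) u = 1 / (1 + tau) * pinball_loss tau u.
Proof.
move=> tau1; rewrite /quantile_loss /pinball_loss.
by case: ltP => _; field.
Qed.

Lemma regression_riskE (R : realType) (n p : nat) (tau : R)
    (xbar : 'M[R]_(n, 1 + p)) (b : 'cV[R]_(1 + p)) : 1 + tau != 0 ->
  regression_risk (1 / (1 + tau)) (const_mx 1) xbar b =
  1 / (1 + tau) * classification_risk tau xbar b.
Proof.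
move=> tau1; rewrite /regression_risk /classification_risk mulrCA.
congr (_ * _); rewrite mulr_sumr; apply: eq_bigr => i _.
by rewrite mxE quantile_lossE.
Qed.

Lemma pinball_lossE (R : realType) (tau u : R) :
  0 <= tau -> pinball_loss tau u = Num.max u (- tau * u).
Proof.
move=> tau0; rewrite /pinball_loss; case: leP => u0.
  by rewrite max_l //; nra.
by rewrite max_r //; nra.
Qed.

Lemma pinball_loss_convex (R : realType) (tau : R) :
  0 <= tau -> convex_function setT (pinball_loss tau : R^o -> R^o).
Proof.
(* Each of the two linear functions commutes with the convex combination, and its values at [u] and
   [v] are bounded by the maxima there. *)
move=> tau0 t u v _ _; rewrite !convRE !pinball_lossE // ge_max.
have t0 : 0 <= t%:num by [].
have t1 : 0 <= 1 - t%:num by rewrite subr_ge0 le1.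
apply/andP; split.
  by rewrite lerD // ler_wpM2l // le_max lexx.
rewrite mulrDr ![- tau * (_ * _)]mulrCA.
by rewrite lerD // ler_wpM2l // le_max lexx orbT.
Qed.

Lemma classification_risk_convex (R : realType) (n p : nat) (tau : R)
    (xbar : 'M[R]_(n, 1 + p)) :
  0 <= tau -> convex_function setT (classification_risk tau xbar).
Proof.
move=> tau0 t b c _ _; rewrite convRE /classification_risk.
rewrite ![_ * (n%:R^-1 * _)]mulrCA -mulrDr.
rewrite ler_wpM2l ?invr_ge0 // !mulr_sumr -big_split /=.
apply: ler_sum => i _.
set u := 1 - \sum_j xbar i j * b j 0; set v := 1 - \sum_j xbar i j * c j 0.
(* The residual is affine in the coefficients: the weights [t] and [1 - t] add up to 1, which
   preserves the constant term. Convexity of the loss thus passes to each summand. *)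
suff -> : 1 - \sum_j xbar i j * conv t b c j 0 = conv t (u : R^o) (v : R^o).
  by apply: pinball_loss_convex; rewrite ?inE.
rewrite convRE /u /v !mulrBr !mulr1 addrACA -opprD subrKC; congr (_ - _).
rewrite !mulr_sumr -big_split /=; apply: eq_bigr => j _.
by rewrite !mxE; ring.
Qed.

Theorem proposition1 (R : realType) (n p : nat) (hn : (0 < n)%N)
    (tau : R) (htau : 0 <= tau)
    (y : 'rV[R]_n) (hy : forall i, y 0 i = -1 \/ y 0 i = 1)
    (X : 'M[R]_(n, p)) (reg : 'cV[R]_(1 + p) -> R) :
  let xbar := signed_design y X in
  let tau_t := 1 / (1 + tau) in
  let y_t : 'cV[R]_n := const_mx 1 in
  let x_t := xbar in
  let obj_c := fun b => classification_risk tau xbar b + reg b in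
  let obj_r := fun b => regression_risk tau_t y_t x_t b + tau_t * reg b in
  argmin obj_c = argmin obj_r /\
  (convex_function setT reg -> convex_function setT obj_r).
Proof.
move=> xbar tau_t y_t x_t obj_c obj_r.
have tau1 : 0 < 1 + tau by rewrite ltr_pwDl.
have tau_t0 : 0 < tau_t by rewrite divr_gt0.
have obj_rE : obj_r = fun b => tau_t * obj_c b.
  by apply: funext => b; rewrite /obj_r regression_riskE ?gt_eqF // -mulrDr.
rewrite obj_rE; split; first by rewrite argmin_pscale.
move=> reg_convex t b c bT cT.
have risk_le := classification_risk_convex xbar htau t bT cT.
have reg_le := reg_convex t b c bT cT.
(* The positive factor [tau_t] cancels, leaving the convexity inequality of [obj_c], which is the
   sum of those of the risk and of [reg]. *)
rewrite convRE ![_ * (tau_t * _)]mulrCA -mulrDr ler_pM2l //.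
apply: le_trans (lerD risk_le reg_le) _.
by rewrite !convRE !mulrDr addrACA.
Qed.
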